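(* Let $[a^{p},b^{q},c^{r}]$ be a uniform passport, where $n=pa=qb=rc$. There exists a regular dessin d'enfant with this passport if and only if there exists an (abstract) group $G$ of order $n$ satisfying the following condition: there exist elements $x,y\in G$ such that $\mathrm{ord}(x)=a$, $\mathrm{ord}(y)=b$, $\mathrm{ord}(xy)=c$, and $G=\langle x,y\rangle$.
   Context: A dessin d'enfant (dessin) is a connected, finite, bipartite graph (vertices colored black and white, each edge joining a black vertex to a white vertex) embedded as a map in a connected, compact, oriented surface without boundary, so that every face is homeomorphic to a disk. Let $E$ be its set of edges and $n=|E|$. Let $x$ (resp. $y$) be the permutation of $E$ sending each edge $e$ to the next edge counterclockwise around the unique black (resp. white) vertex incident to $e$. The monodromy group is $\langle x,y\rangle\le \mathrm{Sym}(E)$; it acts transitively on $E$. Permutations act on the left and are composed from right to left. The cycles of $x$, $y$ and $(xy)^{-1}$ correspond to the black vertices, white vertices and faces, and the cycle lengths are their valencies. Conversely, any pair of permutations $x,y$ of an $n$-element set generating a transitive group arises in this way from a dessin. The passport of a dessin with $n$ edges is the triple $[\lambda_0,\lambda_1,\lambda_\infty]$ of partitions of $n$ given by the valencies of black vertices, white vertices and faces (equivalently the cycle types of $x$, $y$, $(xy)^{-1}$). The notation $a^{p}$ denotes the partition with $p$ parts all equal to $a$. A passport is uniform if it has the form $[a^{p},b^{q},c^{r}]$ with $n=pa=qb=rc$ (all positive integers). A dessin is regular if its monodromy group acts freely (hence regularly) on $E$. $\mathrm{ord}(g)$ denotes the order of a group element $g$. *)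

(* Defs.v *)
From mathcomp Require Import all_boot all_fingroup.

Set Implicit Arguments.
Unset Strict Implicit.
Unset Printing Implicit Defensive.

(* Adjacency in the bipartite graph whose edge e joins s e to t e. *)
Definition bip_adj (B W E : finType) (s : E -> B) (t : E -> W) : rel (B + W) :=
  fun u v => match u, v with
    | inl b, inr w => [exists e, (s e == b) && (t e == w)]
    | inr w, inl b => [exists e, (s e == b) && (t e == w)]
    | _, _ => false
    end.

(* A bipartite graph cellularly embedded in a closed oriented surface is        *)
(* encoded by its rotation system (Heffter-Edmonds): the abstract graph,        *)
(* multiple edges allowed, with the counterclockwise cyclic order of the edges  *)
(* around each vertex. The surface is connected iff the graph is.               *)
(* brotP and wrotP say that the edges at a vertex form one cycle of the         *)
(* corresponding rotation.                                                      *)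
Record dessin := Dessin {
  black : finType;
  white : finType;
  edge : finType;
  bend : edge -> black;
  wend : edge -> white;
  brot : {perm edge};
  wrot : {perm edge};
  edge_gt0 : 0 < #|edge|;
  dessin_connected : forall u v : black + white,
    connect (bip_adj bend wend) u v;
  brotP : forall e, porbit brot e = [set f | bend f == bend e];
  wrotP : forall e, porbit wrot e = [set f | wend f == wend e]
}.

Arguments bend {d} e.
Arguments wend {d} e.

Section DessinTheory.
Variable D : dessin.

Definition black_valency (v : black D) : nat := #|[set e : edge D | bend e == v]|.
Definition white_valency (w : white D) : nat := #|[set e : edge D | wend e == w]|.

(* (xy)^-1 for x = brot D, y = wrot D and composition from right to left:       *)
(* MathComp multiplies permutations from left to right, (s * t) e = t (s e).    *)
Definition face_perm : {perm edge D} := ((wrot D * brot D)^-1)%g.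

Definition faces : {set {set edge D}} := porbits face_perm.

Definition partition_of (s : seq nat) : seq nat := sort geq s.

(* A partition is represented by its nonincreasing sequence of parts. *)
Definition passport : seq nat * seq nat * seq nat :=
  (partition_of [seq black_valency v | v : black D],
   partition_of [seq white_valency w | w : white D],
   partition_of [seq #|f| | f : {set edge D} in faces]).

Definition monodromy : {group {perm edge D}} := <<[set brot D; wrot D]>>%G.

Definition regular : Prop :=
  forall (g : {perm edge D}) (e : edge D), g \in monodromy -> g e = e -> g = 1%g.

End DessinTheory.

(* Main.v *)
Require Import Defs.
From mathcomp Require Import all_boot all_fingroup cyclic.

(** In a regular dessin the connected graph makes the monodromy group act
    regularly on the edges, so its order is [n] and every cycle of an element
    [g] has length [#[g]]; the monodromy group itself is the required group.
    Conversely, a group [G = <<x, y>>] acts regularly on itself by left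
    multiplication, and the cycles of [x], [y] and [xy] are cosets of the cyclic
    subgroups they generate. *)

Set Implicit Arguments.
Unset Strict Implicit.
Unset Printing Implicit Defensive.

Local Open Scope group_scope.

(** * Constant partitions and counting by fibres of equal size *)

Lemma partition_of_nseq k m : partition_of (nseq k m) = nseq k m.
Proof.
apply: sorted_sort; first by move=> u v w /= uv vw; exact: leq_trans vw uv.
by elim: k => [|[|k] IHk] //=; rewrite leqnn.
Qed.

Lemma partition_of_constant (s : seq nat) k m :
    (forall i, i \in s -> i = m) -> size s = k ->
  partition_of s = nseq k m.
Proof.
move=> s_m <-; rewrite -[RHS]partition_of_nseq; congr partition_of.
by apply/all_pred1P/allP => i /s_m ->; rewrite /= eqxx.
Qed.

Lemma mem_partition_of_nseq (s : seq nat) k m i :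
  partition_of s = nseq k m -> i \in s -> i = m.
Proof.
by move=> s_m; rewrite -(mem_sort geq) -/(partition_of s) s_m => /nseqP[].
Qed.

Lemma size_partition_of_nseq (s : seq nat) k m :
  partition_of s = nseq k m -> size s = k.
Proof. by move=> s_m; rewrite -(size_sort geq) -/(partition_of s) s_m size_nseq. Qed.

Lemma card_uniform_fibers (E V : finType) (f : E -> V) m :
    (forall v, #|[set e | f e == v]| = m) -> #|E| = (#|V| * m)%N.
Proof.
move=> fm; rewrite -sum1_card (partition_big f predT) //=.
rewrite -sum_nat_const; apply: eq_bigr => v _; rewrite -(fm v) -sum1_card.
by apply: eq_bigl => e; rewrite inE.
Qed.

Lemma bip_adj_sym (B W E : finType) (s : E -> B) (t : E -> W) :
  symmetric (bip_adj s t).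
Proof. by case=> [u|u] [v|v]. Qed.

(** The powers of [g] lie in [M], so only the identity among them fixes [e]; the orbit-stabilizer
    theorem for [<[g]>] gives the length of the cycle. *)
Lemma card_porbit_free (T : finType) (M : {group {perm T}}) (g : {perm T}) e :
    (forall h u, h \in M -> h u = u -> h = 1) -> g \in M ->
  #|porbit g e| = #[g].
Proof.
move=> free gM; rewrite porbitE card_orbit orderE.
suff -> : 'C_<[g]>[e | 'P] = 1 by rewrite indexg1.
apply/trivgP/subsetP=> h /setIP[hg /astab1P he]; apply/set1P/(free _ e) => //.
by apply: subsetP hg; rewrite cycle_subG.
Qed.

(** * Transitivity and order of the monodromy group *)

Section Monodromy.
Variable D : dessin.

Lemma brot_monodromy : brot D \in monodromy D.
Proof. by apply: mem_gen; rewrite !inE eqxx. Qed.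

Lemma wrot_monodromy : wrot D \in monodromy D.
Proof. by apply: mem_gen; rewrite !inE eqxx orbT. Qed.

Lemma face_perm_monodromy : face_perm D \in monodromy D.
Proof. by rewrite groupV groupM ?brot_monodromy ?wrot_monodromy. Qed.

Lemma porbit_sub_orbit_monodromy (s : {perm edge D}) e0 e f :
    s \in monodromy D -> e \in orbit 'P (monodromy D) e0 -> f \in porbit s e ->
  f \in orbit 'P (monodromy D) e0.
Proof.
move=> sM eO; rewrite porbitE => fs; apply: (orbit_trans (y := e)) => //.
by apply: subsetP fs; apply: imsetS; rewrite cycle_subG.
Qed.

(** The edges at a vertex form one cycle of a rotation, so an orbit containing one of them contains
    them all. Hence the vertices incident to the orbit are closed under adjacency, and connectedness
    leaves no other vertex. *)
Lemma monodromy_transitive e0 : orbit 'P (monodromy D) e0 = setT.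
Proof.
set O := orbit _ _ _.
have sameb e f : e \in O -> bend f = bend e -> f \in O.
  move=> eO fe; apply: porbit_sub_orbit_monodromy brot_monodromy eO _.
  by rewrite brotP inE fe.
have samew e f : e \in O -> wend f = wend e -> f \in O.
  move=> eO fe; apply: porbit_sub_orbit_monodromy wrot_monodromy eO _.
  by rewrite wrotP inE fe.
pose meets_O : pred (black D + white D) := fun u =>
  match u with
  | inl b => [exists e in O, bend e == b]
  | inr w => [exists e in O, wend e == w]
  end.
have adjO u v : bip_adj (@bend D) (@wend D) u v -> meets_O u -> meets_O v.
  case: u v => [b|w] [b'|w'] //= /existsP[f /andP[/eqP fb /eqP fw]];
    case/existsP=> e /andP[eO /eqP eb]; apply/existsP; exists f.
    by rewrite fw eqxx andbT; apply: sameb eO _; rewrite eb.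
  by rewrite fb eqxx andbT; apply: samew eO _; rewrite eb.
have closedO : closed (bip_adj (@bend D) (@wend D)) meets_O.
  move=> u v uv; apply/idP/idP; first exact: adjO.
  by apply: adjO; rewrite bip_adj_sym.
apply/eqP; rewrite -subTset; apply/subsetP=> f _.
(* Some edge of the orbit shares its black end with [f], and [sameb] then puts [f] itself in the
   orbit. *)
have := closed_connect closedO (dessin_connected (inl (bend e0)) (inl (bend f))).
have e0O : meets_O (inl (bend e0)) by apply/existsP; exists e0; rewrite orbit_refl eqxx.
rewrite -!topredE /= in e0O *; rewrite e0O => /esym/existsP[e /andP[eO /eqP ef]].
exact: sameb eO _.
Qed.

Lemma card_regular_monodromy : regular D -> #|monodromy D| = #|edge D|.
Proof.
move=> reg; have /card_gt0P[e0 _] := edge_gt0 D.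
rewrite -cardsT -(monodromy_transitive e0) card_orbit.
suff -> : 'C_(monodromy D)[e0 | 'P] = 1 by rewrite indexg1.
apply/trivgP/subsetP=> h /setIP[hM /astab1P he]; apply/set1P.
exact: reg he.
Qed.

End Monodromy.

(** * The dessin of a transitive pair of permutations *)

Section DessinOfPerms.
Variables (E : finType) (s t : {perm E}).
Hypothesis E_gt0 : 0 < #|E|.
Hypothesis st_trans : forall e f, exists2 g, g \in <<[set s; t]>> & g e = f.

(** The vertices of the dessin are the cycles themselves, fixed points included: those of [s] are
    black, those of [t] white. This is a type whose elements are cycles, not a partition of an
    integer. *)
Local Notation cycle_type_of u := {B : {set E} | B \in porbits u}.

Lemma porbit_in_porbits (u : {perm E}) (e : E) : porbit u e \in porbits u.
Proof. exact: imset_f. Qed.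

Definition cycle_of (u : {perm E}) (e : E) : cycle_type_of u :=
  exist _ (porbit u e) (porbit_in_porbits u e).

Lemma cycle_of_surj u (B : cycle_type_of u) : exists e, B = cycle_of u e.
Proof. by case: B => B BP; have /imsetP[e _ eB] := BP; exists e; apply: val_inj. Qed.

Lemma eq_cycle_of u e f : (cycle_of u e == cycle_of u f) = (e \in porbit u f).
Proof. by rewrite -val_eqE /= eq_porbit_mem. Qed.

Lemma cycle_of_porbit u e : porbit u e = [set f | cycle_of u f == cycle_of u e].
Proof. by apply/setP=> f; rewrite inE eq_cycle_of. Qed.

Lemma cycle_of_perm u e : cycle_of u (u e) = cycle_of u e.
Proof. by apply/eqP; rewrite eq_cycle_of (mem_porbit u 1). Qed.

Lemma perms_connected (u v : cycle_type_of s + cycle_type_of t) :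
  connect (bip_adj (cycle_of s) (cycle_of t)) u v.
Proof.
set adj := bip_adj _ _.
have csym : connect_sym adj := sym_connect_sym (@bip_adj_sym _ _ _ _ _).
have bw e : connect adj (inl (cycle_of s e)) (inr (cycle_of t e)).
  by apply: connect1; apply/existsP; exists e; rewrite !eqxx.
(* [H] collects the permutations that move no edge out of its connected component. It is a group, so
   it is enough to find [s] and [t] in it; transitivity then joins all black vertices. *)
pose H := [set g : {perm E} |
  [forall e, connect adj (inl (cycle_of s e)) (inl (cycle_of s (g e)))]].
have gH : group_set H.
  apply/group_setP; split; first by rewrite inE; apply/forallP=> e; rewrite perm1.
  move=> g h; rewrite !inE => /forallP gP /forallP hP; apply/forallP=> e.
  by rewrite permM; apply: connect_trans (gP e) (hP _).
have stH : <<[set s; t]>> \subset group gH.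
  rewrite gen_subG; apply/subsetP=> g /set2P[]->; rewrite inE; apply/forallP=> e.
    by rewrite cycle_of_perm.
  (* The edges [e] and [t e] share a white vertex, through which their black ends are joined. *)
  apply: connect_trans (bw e) _; rewrite -(cycle_of_perm t) csym; exact: bw.
have bb e f : connect adj (inl (cycle_of s e)) (inl (cycle_of s f)).
  have [g /(subsetP stH)] := st_trans e f.
  by rewrite inE => /forallP/(_ e) + <-.
have toblack w : exists e, connect adj w (inl (cycle_of s e)).
  case: w => B; have [e ->] := cycle_of_surj B; exists e; first exact: connect0.
  by rewrite csym.
have [[e ue] [f vf]] := (toblack u, toblack v).
by apply: connect_trans ue (connect_trans (bb e f) _); rewrite csym.
Qed.

Definition dessin_of_perms : dessin :=
  Dessin E_gt0 perms_connected (cycle_of_porbit s) (cycle_of_porbit t).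

Lemma partition_of_cycle_valencies u k m :
    #|E| = (k * m)%N -> (forall e, #|porbit u e| = m) ->
  partition_of [seq #|[set e | cycle_of u e == v]| | v : cycle_type_of u] = nseq k m.
Proof.
move=> Ekm um.
have fib v : #|[set e | cycle_of u e == v]| = m.
  by have [e ->] := cycle_of_surj v; rewrite -cycle_of_porbit.
apply: partition_of_constant => [i /imageP[v _ ->] //|].
rewrite size_map -cardE; apply/eqP.
(* Since [E] is nonempty, [m] can be cancelled from the two counts of [E], which leaves [k] as the
   number of cycles. *)
have m_gt0 : 0 < m by case: (m) Ekm E_gt0 => // ->; rewrite muln0.
by rewrite -(eqn_pmul2r m_gt0) -Ekm (card_uniform_fibers fib).
Qed.

Lemma partition_of_porbits (u : {perm E}) k m :
    #|E| = (k * m)%N -> (forall e, #|porbit u e| = m) ->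
  partition_of [seq #|B| | B : {set E} in porbits u] = nseq k m.
Proof.
move=> Ekm um.
have constm (B : {set E}) : B \in porbits u -> #|B| = m by case/imsetP=> e _ ->.
apply: partition_of_constant => [i /imageP[B /constm Bm ->] //|].
rewrite size_map -cardE; apply/eqP.
have m_gt0 : 0 < m by case: (m) Ekm E_gt0 => // ->; rewrite muln0.
have part : partition (porbits u) [set: E].
  have := orbit_partition (to := 'P) (G := <[u]>) (S := [set: E]).
  rewrite (_ : orbit _ _ @: _ = porbits u); first by apply; apply/actsP=> h _ e; rewrite !inE.
  by apply/setP=> B; apply/imsetP/imsetP=> -[e _ ->]; exists e; rewrite ?inE // porbitE.
by rewrite -(eqn_pmul2r m_gt0) -Ekm -cardsT (card_uniform_partition constm part).
Qed.

Lemma passport_dessin_of_perms a b c p q r :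
    #|E| = (p * a)%N -> #|E| = (q * b)%N -> #|E| = (r * c)%N ->
    (forall e, #|porbit s e| = a) -> (forall e, #|porbit t e| = b) ->
    (forall e, #|porbit (t * s)^-1 e| = c) ->
  passport dessin_of_perms = (nseq p a, nseq q b, nseq r c).
Proof.
move=> Ea Eb Ec sa tb stc; congr (_, _, _).
- exact: partition_of_cycle_valencies.
- exact: partition_of_cycle_valencies.
- exact: partition_of_porbits.
Qed.

End DessinOfPerms.

(** * The left regular action of a group *)

Section LeftMultiplication.
Variable G : finGroupType.
Implicit Types g h x y : G.

Definition lmul g : {perm G} := perm (mulgI g).
Definition rmul g : {perm G} := perm (mulIg g).

(** The factors are reversed because permutations compose from left to right: [lmul] is an
    antimorphism. *)
Lemma lmulM g h : lmul g * lmul h = lmul (h * g).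
Proof. by apply/permP=> e; rewrite permM !permE mulgA. Qed.

Lemma lmul1 : lmul 1 = 1.
Proof. by apply/permP=> e; rewrite permE perm1 mul1g. Qed.

Lemma lmulX g k : lmul g ^+ k = lmul (g ^+ k).
Proof. by elim: k => [|k IHk]; rewrite ?expg0 ?lmul1 // expgSr IHk lmulM -expgS. Qed.

Lemma lmul_inj : injective lmul.
Proof. by move=> g h /permP/(_ 1); rewrite !permE !mulg1. Qed.

Lemma order_lmul g : #[lmul g] = #[g].
Proof.
apply/eqP; rewrite eqn_dvd !order_dvdn lmulX expg_order lmul1 eqxx /=.
by rewrite -(inj_eq lmul_inj) -lmulX expg_order lmul1.
Qed.

(* Left multiplications commute with all right multiplications, which act
   transitively; hence nothing they generate can fix a point. *)
Lemma lmul_free x y (g : {perm G}) e :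
  g \in <<[set lmul x; lmul y]>> -> g e = e -> g = 1.
Proof.
move=> gM ge; apply/permP=> f; rewrite perm1.
have sC : <<[set lmul x; lmul y]>> \subset 'C([set rmul h | h : G]).
  rewrite gen_subG; apply/subsetP=> u uxy; apply/centP=> _ /imsetP[h _ ->].
  by case/set2P: uxy => ->; apply/permP=> k; rewrite !permM !permE mulgA.
have /centP gC := subsetP sC g gM.
have /permP/(_ e) := gC _ (imset_f rmul (isT : e^-1 * f \in G)).
by rewrite !permM ge !permE mulKVg.
Qed.

(** The elements whose left multiplication lies in the generated group form a subgroup of [G]
    containing [x] and [y]. *)
Lemma lmul_generated x y h :
  [set: G] = <<[set x; y]>> -> lmul h \in <<[set lmul x; lmul y]>>.
Proof.
move=> Gxy; set M := <<_>>%g.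
have gH : group_set [set k | lmul k \in M].
  apply/group_setP; split=> [|u v]; first by rewrite inE lmul1 group1.
  by rewrite !inE => uM vM; rewrite -lmulM groupM.
suff : [set: G] \subset group gH by move/subsetP/(_ h (in_setT h)); rewrite inE.
rewrite Gxy gen_subG; apply/subsetP=> k /set2P[]->; rewrite inE;
  by apply: mem_gen; rewrite !inE eqxx ?orbT.
Qed.

Lemma lmul_transitive x y : [set: G] = <<[set x; y]>> ->
  forall e f, exists2 g : {perm G}, g \in <<[set lmul x; lmul y]>> & g e = f.
Proof.
move=> Gxy e f; exists (lmul (f * e^-1)); first exact: lmul_generated.
by rewrite permE mulgKV.
Qed.

End LeftMultiplication.

(** The two products are conjugate by [y]. *)
Lemma order_mulgC (gT : finGroupType) (x y : gT) : #[x * y] = #[y * x].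
Proof. by rewrite -[RHS](orderJ _ y) conjgE mulgA mulKg. Qed.

Lemma order_subg (gT : finGroupType) (M : {group gT}) (u : subg_of M) :
  #[u] = #[sgval u].
Proof. by rewrite -(order_injm (injm_sgval M)) ?inE. Qed.

(** The injection [sgval] sends both sides to [<<[set x; y]>>], so they agree already in the
    subgroup type. *)
Lemma subg_generated (gT : finGroupType) (x y : gT)
    (u v : subg_of <<[set x; y]>>) :
  sgval u = x -> sgval v = y -> [set: subg_of <<[set x; y]>>] = <<[set u; v]>>.
Proof.
move=> ux vy; apply: (injm_morphim_inj (injm_sgval _)); rewrite ?subsetT //.
rewrite -/(sgval @* [subg _])%g im_sgval morphim_gen ?subsetT //.
by rewrite morphimU !morphim_set1 ?inE //= ux vy.
Qed.

Local Close Scope group_scope.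

Theorem proposition6p3 (n a b c p q r : nat)
    (hn : 0 < n) (ha : n = p * a) (hb : n = q * b) (hc : n = r * c) :
  (exists D : dessin,
     regular D /\ passport D = (nseq p a, nseq q b, nseq r c)) <->
  (exists G : finGroupType,
     #|G| = n /\
     exists x y : G,
       [/\ #[x]%g = a, #[y]%g = b, #[(x * y)%g]%g = c
         & [set: G] = <<[set x; y]>>%g]).
Proof.
split=> [[D [reg [passb passw passf]]] | [G [Gn [x [y [xa yb xyc Gxy]]]]]].
  have /card_gt0P[e0 _] := edge_gt0 D.
  have cycle_order g : g \in monodromy D -> #|porbit g e0| = #[g]%g.
    by apply: card_porbit_free => h u hM; apply: reg hM.
  have xa : #[brot D]%g = a.
    rewrite -(cycle_order _ (brot_monodromy D)) brotP.
    exact: mem_partition_of_nseq passb (codom_f (@black_valency D) (bend e0)).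
  have yb : #[wrot D]%g = b.
    rewrite -(cycle_order _ (wrot_monodromy D)) wrotP.
    exact: mem_partition_of_nseq passw (codom_f (@white_valency D) (wend e0)).
  (* The faces are cycles of the inverse of [wrot D * brot D]; neither inverting nor exchanging the
     factors changes the order. *)
  have xyc : #[(brot D * wrot D)]%g = c.
    rewrite order_mulgC -orderV -/(face_perm D).
    rewrite -(cycle_order _ (face_perm_monodromy D)).
    apply: mem_partition_of_nseq passf _.
    by apply: image_f; apply: imset_f; rewrite inE.
  (* The edges are counted by their black ends: [p] vertices of valency [a]. *)
  have En : #|edge D| = n.
    rewrite ha -(size_partition_of_nseq passb) size_map -cardE.
    apply: card_uniform_fibers (bend) _ _ => v.
    exact: mem_partition_of_nseq passb (codom_f (@black_valency D) v).
  (* [subg_of] turns the monodromy group, a subset of the symmetric group, into a group type of its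
     own. *)
  exists (subg_of (monodromy D)); split.
    by rewrite -cardsT -(card_injm (injm_sgval _)) ?im_sgval ?card_regular_monodromy.
  exists (subg _ (brot D)), (subg _ (wrot D)).
  have bK := subgK _ (brot_monodromy D).
  have wK := subgK _ (wrot_monodromy D).
  split; rewrite ?order_subg ?bK ?wK //.
  - by rewrite /= bK wK.
  - exact: subg_generated.
have G_gt0 : 0 < #|G| by rewrite Gn.
(* The edges are the elements of [G], with rotations [lmul x] at black and [lmul y] at white
   vertices. *)
exists (dessin_of_perms G_gt0 (lmul_transitive Gxy)); split.
  by move=> g e; apply: lmul_free.
have cycle_order g : g \in <<[set lmul x; lmul y]>>%g ->
    forall e, #|porbit g e| = #[g]%g.
  by move=> gM e; apply: card_porbit_free gM => h u; apply: lmul_free.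
apply: passport_dessin_of_perms; rewrite ?Gn // => e; rewrite cycle_order.
(* For the faces, [lmulM] turns [lmul y * lmul x] into [lmul (x * y)], whose order is [c]. *)
all: rewrite ?lmulM ?groupV ?lmul_generated ?orderV ?order_lmul //.
Qed.
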